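(* Let $G$ be a finite connected simple $(t+1)$-regular graph with $n_V$ vertices and $n_E$ edges. Then, as rational functions of $q$ (for any $u$), \[ \zeta_G(q,1-t-u)=\left(\frac{1-(1-u)^2q^2}{1-(t+u)^2q^2}\right)^{n_E-n_V}\zeta_G(q,u). \] Equivalently, the completed Bartholdi zeta function $\xi_G(q,u)=\bigl(1-(1-u)^2q^2\bigr)^{n_E-\frac{n_V}{2}}\bigl(1-(t+u)^2q^2\bigr)^{\frac{n_V}{2}}\zeta_G(q,u)$ satisfies $\xi_G(q,1-t-u)=\xi_G(q,u)$.
   Context: $A$ is the adjacency matrix of $G$, $D=\mathrm{diag}(\deg v)$, $Q_u=(1-u)\bigl(D-(1-u)I_{n_V}\bigr)$. The Bartholdi zeta function is defined for small $|q|,|u|$ by the Euler product $\zeta_G(q,u)=\prod_{[C]}(1-q^{|C|}u^{b(C)})^{-1}$ over rotation-equivalence classes of primitive cycles $C$ (closed walks on directed edges), where $|C|$ is the length and $b(C)$ the number of bumps (consecutive traversal of an edge and its reverse, counted cyclically). It is known to equal $(1-(1-u)^2q^2)^{-(n_E-n_V)}\det(I_{n_V}-qA+q^2Q_u)^{-1}$, which for a $(t+1)$-regular graph is $(1-(1-u)^2q^2)^{-(n_E-n_V)}\det\bigl((1+(1-u)(t+u)q^2)I_{n_V}-qA\bigr)^{-1}$; $\zeta_G(q,u)$ denotes this rational function for all $q,u$. *)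

(* Defs.v *)
From HB Require Import structures.
From mathcomp Require Import all_boot all_order all_algebra.
From mathcomp Require Import reals complex.
Set Implicit Arguments.
Unset Strict Implicit.
Unset Printing Implicit Defensive.
Import Order.TTheory GRing.Theory Num.Theory.
Local Open Scope ring_scope.

Record sgraph := SGraph {
  vertex :> finType;
  adj : rel vertex;
  adj_sym : symmetric adj;
  adj_irrefl : irreflexive adj
}.

Arguments adj {s} _ _.

Definition edges (G : sgraph) : {set {set G}} :=
  [set E : {set G} | [exists x, exists y, adj x y && (E == [set x; y])]].

Definition nV (G : sgraph) : nat := #|G|.

Definition nE (G : sgraph) : nat := #|edges G|.

Definition deg (G : sgraph) (v : G) : nat := #|[set w | adj v w]|.

Definition connected_graph (G : sgraph) : Prop :=
  (0 < nV G)%N /\ forall x y : G, connect (@adj G) x y.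

Definition regular (G : sgraph) (d : int) : Prop :=
  forall v : G, (deg v)%:Z = d.

Definition adjacency (K : fieldType) (G : sgraph) : 'M[K]_(nV G) :=
  \matrix_(i, j) (adj (enum_val i : G) (enum_val j : G))%:R.

Definition degree_mx (K : fieldType) (G : sgraph) : 'M[K]_(nV G) :=
  diag_mx (\row_i (deg (enum_val i : G))%:R).

Definition Qmx (K : fieldType) (G : sgraph) (u : K) : 'M[K]_(nV G) :=
  (1 - u) *: (degree_mx K G - (1 - u)%:M).

(* The rational expression that continues the Euler product
     \prod_[C] (1 - q^|C| u^b(C))^-1
   to all q and u.  The field K is arbitrary, so that q can be either a complex
   number or the indeterminate of the field of rational functions. *)
Definition zeta (K : fieldType) (G : sgraph) (q u : K) : K :=
  (1 - (1 - u) ^+ 2 * q ^+ 2) ^ (- ((nE G)%:Z - (nV G)%:Z))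
  * (\det (1%:M - q *: adjacency K G + q ^+ 2 *: Qmx G u))^-1.

(* zeta_G(q, u) as an element of the field C(q), for a fixed number u. *)
Definition zeta_rat (R : realType) (G : sgraph) (u : R[i]) :
    {fraction {poly R[i]}} :=
  zeta G (tofrac 'X) (tofrac u%:P).

(* z to the power k/2; sqrtc is the principal square root. *)
Definition half_pow (R : realType) (z : R[i]) (k : int) : R[i] := sqrtc z ^ k.

Definition xi (R : realType) (G : sgraph) (t : int) (q u : R[i]) : R[i] :=
  half_pow (1 - (1 - u) ^+ 2 * q ^+ 2) (2 * (nE G)%:Z - (nV G)%:Z)
  * half_pow (1 - (t%:~R + u) ^+ 2 * q ^+ 2) (nV G)%:Z
  * zeta G q u.

(* Main.v *)
Require Import Defs.
From mathcomp Require Import all_boot all_order all_algebra.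
From mathcomp Require Import reals complex.
From mathcomp Require Import ring.
Import Order.TTheory GRing.Theory Num.Theory.
Local Open Scope ring_scope.

(** The involution [u |-> 1 - t - u] exchanges [1 - u] and [t + u].  On a
    [(t+1)]-regular graph [Q_u] is the scalar matrix [(1 - u) (t + u)], hence
    invariant, so only the prefactor [1 - (1 - u)^2 q^2] of zeta changes. *)

Lemma Qmx_regular (K : fieldType) (G : sgraph) (t : int) (u : K) :
  regular G (t + 1) -> Qmx G u = ((1 - u) * (t%:~R + u))%:M.
Proof.
move=> hreg; rewrite /Qmx.
have -> : degree_mx K G = (t + 1)%:~R%:M.
  rewrite /degree_mx -diag_const_mx; congr diag_mx; apply/rowP=> i.
  by rewrite !mxE -(hreg (enum_val i)).
by rewrite -raddfB /= scale_scalar_mx; congr _%:M; rewrite intrD; ring.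
Qed.

Lemma zeta_reflect (K : fieldType) (G : sgraph) (t : int) (q u : K) :
  regular G (t + 1) ->
  zeta G q (1 - t%:~R - u) =
    (1 - (t%:~R + u) ^+ 2 * q ^+ 2) ^ (- ((nE G)%:Z - (nV G)%:Z))
    * (\det (1%:M - q *: adjacency K G + q ^+ 2 *: Qmx G u))^-1.
Proof.
move=> hreg; rewrite /zeta !(Qmx_regular _ _ _ _ hreg).
have -> : 1 - (1 - t%:~R - u) = t%:~R + u by ring.
have -> : t%:~R + (1 - t%:~R - u) = 1 - u by ring.
by rewrite [_ * (1 - u)]mulrC.
Qed.

(* For [z = 0] both sides vanish: [0 ^ k = 0] for every nonzero integer [k], and
   the two exponents on the left are both zero only when [n = 0]. *)
Lemma half_pow_mul_expz (R : realType) (z : R[i]) (m n : int) : n != 0 ->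
  half_pow z (2 * m - n) * z ^ (- (m - n)) = half_pow z n.
Proof.
move=> n0; rewrite /half_pow; set s := sqrtc z.
(* Written as powers of [s], the exponents on the left add up to [n]:
   [(2 * m - n) - 2 * (m - n) = n]. *)
have -> : z = s ^ 2%:Z by rewrite -exprnP sqr_sqrtc.
rewrite exprz_exp; have [->|s0] := eqVneq s 0; last first.
  by rewrite -expfzDr //; congr (_ ^ _); ring.
rewrite exp0rz [in RHS]exp0rz (negPf n0) exp0rz.
have [h|_] := eqVneq (2 * m - n) 0; last by rewrite mul0r.
suff /negPf -> : 2%:Z * - (m - n) != 0 by rewrite mulr0.
have -> : 2%:Z * - (m - n) = n - (2 * m - n) by ring.
by rewrite h subr0.
Qed.

(** The underlying polynomial takes the value 1 at 0. This allows opposite integer powers of the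
    prefactor to cancel in the field of rational functions. *)
Lemma one_sub_sqr_X_neq0 (F : fieldType) (a : F) :
  1 - tofrac a%:P ^+ 2 * tofrac 'X ^+ 2 != 0 :> {fraction {poly F}}.
Proof.
rewrite -!rmorphXn -rmorphM -(rmorph1 (@tofrac {poly F})) -rmorphB tofrac_eq0.
apply/eqP=> /(congr1 (horner^~ 0)) /eqP.
by rewrite !hornerE /= mulr0 subr0 oner_eq0.
Qed.

Theorem theorem3p4 (R : realType) (G : sgraph) (t : int)
    (hconn : connected_graph G) (hreg : regular G (t + 1)) :
  (forall u : R[i],
     let q : {fraction {poly R[i]}} := tofrac 'X in
     let c (z : R[i]) : {fraction {poly R[i]}} := tofrac z%:P in
     zeta_rat G (1 - t%:~R - u) =
       ((1 - (1 - c u) ^+ 2 * q ^+ 2) / (1 - (c (t%:~R) + c u) ^+ 2 * q ^+ 2))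
         ^ ((nE G)%:Z - (nV G)%:Z)
       * zeta_rat G u)
  /\ (forall q u : R[i], xi G t q (1 - t%:~R - u) = xi G t q u).
Proof.
split=> [u q c|q u].
  have cB x y : c (x - y) = c x - c y by rewrite /c !rmorphB.
  have c1 : c 1 = 1 by rewrite /c !rmorph1.
  have ct : c t%:~R = t%:~R by rewrite /c !rmorph_int.
  have a0 : 1 - (1 - c u) ^+ 2 * q ^+ 2 != 0.
    by rewrite -c1 -cB c1; exact: one_sub_sqr_X_neq0.
  rewrite /zeta_rat -/q -!/(c _) !cB c1 ct (zeta_reflect _ _ _ _ _ hreg).
  rewrite /zeta; move: (1 - _ * _) (1 - (t%:~R + _) ^+ 2 * _) a0 => a b a0.
  rewrite [RHS]mulrA; congr (_ * _).
  (* With [k] the exponent, [(a / b) ^ k * a ^ (- k) = b ^ (- k)], as [a != 0]. *)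
  by rewrite expfzMl exprz_inv [RHS]mulrAC -expfzDr // subrr expr0z mul1r.
(* Connectedness includes nonemptiness, which supplies the nonzero exponent for
   [half_pow_mul_expz]. *)
have n0 : (nV G)%:Z != 0 by case: hconn => [+ _]; rewrite -lt0n.
rewrite /xi (zeta_reflect _ _ _ _ _ hreg) /zeta.
have -> : 1 - (1 - t%:~R - u) = t%:~R + u by ring.
have -> : t%:~R + (1 - t%:~R - u) = 1 - u by ring.
set a := 1 - (1 - u) ^+ 2 * _; set b := 1 - (t%:~R + u) ^+ 2 * _.
rewrite !mulrA; congr (_ * _).
(* The zeta prefactor is absorbed into the half power of [b] on the left and of [a] on the right;
   both sides become the product of the half powers of [a] and [b] with exponent [nV G]. *)
by rewrite mulrAC half_pow_mul_expz // [RHS]mulrAC half_pow_mul_expz // mulrC.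
Qed.
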